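(* $\mathcal{M}_u$ is a subspace of the space $\mathcal{M}_u(\Delta)$.
   Context: $\Omega$ is the vector space of all real double sequences $x=(x_{mn})_{m,n\ge 0}$. Terms with a negative index are taken to be $0$. The difference transform of $x\in\Omega$ is $\Delta x=((\Delta x)_{mn})$ with $(\Delta x)_{mn}=x_{mn}-x_{m,n-1}-x_{m-1,n}+x_{m-1,n-1}$. $\mathcal{M}_u=\{x\in\Omega:\sup_{m,n}|x_{mn}|<\infty\}$ and $\mathcal{M}_u(\Delta)=\{x\in\Omega:\Delta x\in\mathcal{M}_u\}$. *)

(* Defs.v *)
From mathcomp Require Import all_boot all_order all_algebra.
From mathcomp Require Import all_classical all_reals ereal.

Set Implicit Arguments.
Unset Strict Implicit.
Unset Printing Implicit Defensive.

Import Order.TTheory GRing.Theory Num.Theory.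
Local Open Scope classical_set_scope.
Local Open Scope ring_scope.

(* [R^o] is [R] viewed as a module over itself, so that [Omega R] carries the
   pointwise [lmodType R] structure. *)
Notation Omega R := (nat -> nat -> R^o).

Section DoubleSequences.
Variable R : realType.
Implicit Types x : Omega R.

(* The term of [x] at integer indices, 0 as soon as one index is negative. *)
Definition term x (m n : int) : R :=
  match m, n with
  | Posz i, Posz j => x i j
  | _, _ => 0
  end.

Definition Delta x : Omega R := fun m n =>
  term x m n - term x m (n%:Z - 1) - term x (m%:Z - 1) n
  + term x (m%:Z - 1) (n%:Z - 1).

(* The supremum is taken in the extended reals, where it always exists. *)
Definition Mu : set (Omega R) :=
  [set x | (ereal_sup [set `|x p.1 p.2|%:E | p in [set: nat * nat]] < +oo)%E].

Definition MuDelta : set (Omega R) := [set x | Mu (Delta x)].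

End DoubleSequences.

(* [A] is a linear subspace of the vector space [B], both being given as
   subsets of an ambient vector space [V] whose operations they inherit. *)
Definition is_subspace_of (R : realType) (V : lmodType R) (A B : set V) : Prop :=
  [/\ submod_closed (mem B), submod_closed (mem A) & A `<=` B].

(* Main.v *)
Require Import Defs.
From mathcomp Require Import all_boot all_order all_algebra.
From mathcomp Require Import all_classical all_reals ereal.

Import Order.TTheory GRing.Theory Num.Theory.
Local Open Scope classical_set_scope.
Local Open Scope ring_scope.

(** Finiteness of the supremum of the |x_mn| means that one real number bounds
    all of them ([MuP]).  In that form [Mu] is visibly a linear subspace, by the
    triangle inequality ([Mu_submod_closed]).  Since [Delta] is a linear
    operator ([Delta_linear]), its preimage [MuDelta] of the subspace [Mu] is
    again a subspace.  Finally each term of [Delta x] is a signed sum of four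
    values that are entries of x or 0, so a bound M on x gives the bound 4M on
    [Delta x] ([Mu_Delta]), which is the inclusion. *)

Lemma MuP (R : realType) (x : Omega R) :
  Mu x <-> exists M : R, forall m n, `|x m n| <= M.
Proof.
split=> [|[M xM]]; rewrite /Mu /=; last first.
  apply: (@le_lt_trans _ _ M%:E); last exact: ltry.
  by apply: ge_ereal_sup => _ [p _ <-]; rewrite lee_fin.
set S := [set _ | _ in _] => supS.
have le_sup m n : (`|x m n|%:E <= ereal_sup S)%E.
  by apply: ereal_sup_ubound; exists (m, n).
exists (fine (ereal_sup S)) => m n.
(* The entry of index (0, 0) keeps the supremum above -oo. *)
have sup_fin : ereal_sup S \is a fin_num.
  by rewrite fin_real// supS andbT (lt_le_trans _ (le_sup 0 0))// ltNyr.
by rewrite -lee_fin fineK.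
Qed.

Lemma Mu_submod_closed (R : realType) : submod_closed (mem (@Mu R)).
Proof.
split=> [|a x y].
  by apply/mem_set/MuP; exists 0 => m n; rewrite normr0.
move=> /set_mem/MuP[M xM] /set_mem/MuP[N yN]; apply/mem_set/MuP.
exists (`|a| * M + N) => m n.
apply: (le_trans (ler_normD (a * x m n) (y m n))).
by rewrite normrM lerD// ler_wpM2l.
Qed.

Lemma term_linear (R : realType) (a : R) (x y : Omega R) (m n : int) :
  term (a *: x + y) m n = a * term x m n + term y m n.
Proof. by case: m n => [m|m] [n|n] //=; rewrite mulr0 addr0. Qed.

Lemma Delta_linear (R : realType) : linear (@Delta R).
Proof.
move=> a x y; apply/funext => m; apply/funext => n.
rewrite /Delta !term_linear.
rewrite [RHS]/(a * Delta x m n + Delta y m n) /Delta !mulrDr !mulrN !opprD.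
by rewrite [LHS](AC (((2*2)*2)*2) ((1*3*5*7)*(2*4*6*8))).
Qed.

(** The values 0 at negative indices do not spoil a bound on x, because any
    such bound is nonnegative. *)
Lemma term_bound {R : realType} (x : Omega R) (M : R) :
  (forall m n, `|x m n| <= M) -> forall m n, `|term x m n| <= M.
Proof.
move=> xM; have M0 : 0 <= M by exact: le_trans (xM 0 0).
by case=> [m|m] [n|n] //=; rewrite normr0.
Qed.

Lemma Mu_Delta (R : realType) (x : Omega R) : Mu x -> Mu (Delta x).
Proof.
move=> /MuP[M /term_bound xM]; apply/MuP; exists (M + M + M + M) => m n.
rewrite /Delta; apply: (le_trans (ler_normD _ _)); apply: lerD => //.
do 2![apply: (le_trans (ler_normB _ _)); apply: lerD => //].
Qed.

Theorem theorem2p3 (R : realType) : is_subspace_of (@Mu R) (@MuDelta R).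
Proof.
have [Mu0 MuL] := Mu_submod_closed R.
split; [split=> [|a x y] | exact: Mu_submod_closed | exact: Mu_Delta].
  (* 0 is bounded, so the inclusion puts it in [MuDelta]. *)
  by apply/mem_set/Mu_Delta/set_mem.
move=> /set_mem Dx /set_mem Dy; apply/mem_set; rewrite /MuDelta /= Delta_linear.
by apply/set_mem/MuL; exact/mem_set.
Qed.
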